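(* Let $d$ be a positive integer, let $N_1\leq\cdots\leq N_d$ be positive integers, and set $N=N_1\cdots N_{d-1}$. Then the maximal nonnegative rank of nonnegative tensors of format $N_1\times\cdots\times N_d$ is $N$; that is, the maximum of the nonnegative ranks of all elements of $\mathbb{R}_{\geq 0}^{N_1\times\cdots\times N_d}$ is equal to $N$.
   Context: Let $\mathbb{R}_{\geq 0}=\{x\in\mathbb{R}\mid x\geq 0\}$. $\mathbb{R}_{\geq 0}^{N_1\times\cdots\times N_d}$ denotes the set of arrays $T=(t_{i_1\cdots i_d})$, $1\leq i_j\leq N_j$, with entries in $\mathbb{R}_{\geq 0}$; its elements are called nonnegative tensors of format $N_1\times\cdots\times N_d$. A nonzero nonnegative tensor $T$ has nonnegative rank 1 if there are vectors $v_j=(v_{j1},\ldots,v_{jN_j})^\top\in \mathbb{R}_{\geq 0}^{N_j}$, $1\leq j\leq d$, with $t_{i_1\cdots i_d}=\prod_{j=1}^d v_{ji_j}$ for all $(i_1,\ldots,i_d)$. In general the nonnegative rank of a nonnegative tensor $T$ is the minimum number $r$ such that $T$ is a sum of $r$ nonnegative tensors of nonnegative rank 1 (the empty sum being zero, so the zero tensor has nonnegative rank 0). The empty product (the value of $N$ when $d=1$) is $1$. *)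

(* Defs.v *)
From mathcomp Require Import all_boot all_order all_algebra.
From mathcomp Require Import boolp reals.

Set Implicit Arguments.
Unset Strict Implicit.
Unset Printing Implicit Defensive.

Import Order.TTheory GRing.Theory Num.Theory.
Local Open Scope ring_scope.

(* Multi-indices (i_1, ..., i_d), numbered from 0: the j-th component lies in
   {0, ..., N j - 1}. *)
Definition multi_index (d : nat) (N : 'I_d -> nat) :=
  {dffun forall j : 'I_d, 'I_(N j)}.

Definition tensor (R : realType) (d : nat) (N : 'I_d -> nat) :=
  {ffun multi_index N -> R}.

Definition nonneg_tensor (R : realType) (d : nat) (N : 'I_d -> nat)
    (T : tensor R N) : Prop :=
  forall i : multi_index N, 0 <= T i.

Definition nonneg_rank1 (R : realType) (d : nat) (N : 'I_d -> nat)
    (T : tensor R N) : Prop :=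
  [/\ T != 0, nonneg_tensor T &
      exists2 v : forall j : 'I_d, 'cV[R]_(N j),
        forall j k, 0 <= v j k 0 &
        forall i : multi_index N, T i = \prod_(j < d) v j (i j) 0].

Definition sum_of_nonneg_rank1 (R : realType) (d : nat) (N : 'I_d -> nat)
    (T : tensor R N) (r : nat) : Prop :=
  exists2 S : 'I_r -> tensor R N,
    forall k, nonneg_rank1 (S k) & T = \sum_(k < r) S k.

(* The value 0 in the second branch is never used for a nonnegative tensor
   with d > 0: see [nonneg_rankP]. *)
Definition nonneg_rank (R : realType) (d : nat) (N : 'I_d -> nat)
    (T : tensor R N) : nat :=
  match pselect (exists r, `[< sum_of_nonneg_rank1 T r >]) with
  | left ex_r => ex_minn ex_r
  | right _ => 0%N
  end.

Lemma sum_of_nonneg_rank1_exists (R : realType) (d : nat) (N : 'I_d -> nat)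
    (T : tensor R N) :
  (0 < d)%N -> nonneg_tensor T -> exists r, sum_of_nonneg_rank1 T r.
Proof.
move=> d_gt0 T_ge0; pose A := [set i | T i != 0].
pose E (i : multi_index N) : tensor R N := [ffun i' => T i *+ (i' == i)].
exists #|A|; exists (fun k => E (enum_val k)) => [k|].
  have := enum_valP k; set i := enum_val k; rewrite inE => Ti_neq0.
  split.
  - by apply/eqP => /ffunP/(_ i); rewrite !ffunE eqxx => /eqP; apply/negP.
  - by move=> i'; rewrite ffunE mulrn_wge0.
  pose j0 := Ordinal d_gt0.
  exists (fun j => \col_a ((if j == j0 then T i else 1) *+ (a == i j))).
    by move=> j a; rewrite mxE mulrn_wge0//; case: ifP.
  move=> i'; rewrite ffunE; have [->|neq] := eqVneq i' i.
    rewrite (bigD1 j0)//= mxE !eqxx big1 ?mulr1// => j /negPf j_neq.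
    by rewrite mxE j_neq eqxx.
  have [j ij_neq] : exists j, i' j != i j.
    apply/existsP; rewrite -negb_forall; apply: contra neq => /forallP eq_i.
    by apply/eqP/ffunP => j; apply/eqP.
  by rewrite (bigD1 j)//= mxE (negPf ij_neq) mulr0n mul0r.
rewrite -(big_enum_val E).
apply/ffunP => i; rewrite sum_ffunE.
have [Ti0|Ti_neq0] := eqVneq (T i) 0.
  rewrite Ti0 big1// => i'; rewrite inE ffunE => Ti'.
  by case: eqVneq => // ii'; rewrite -ii' Ti0 eqxx in Ti'.
rewrite (bigD1 i) ?inE//= ffunE eqxx big1 ?addr0// => i' /andP[_ neq].
by rewrite ffunE eq_sym (negPf neq).
Qed.

Lemma nonneg_rankP (R : realType) (d : nat) (N : 'I_d -> nat)
    (T : tensor R N) :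
  (0 < d)%N -> nonneg_tensor T ->
  sum_of_nonneg_rank1 T (nonneg_rank T) /\
  forall r, sum_of_nonneg_rank1 T r -> (nonneg_rank T <= r)%N.
Proof.
move=> d_gt0 T_ge0; rewrite /nonneg_rank; case: pselect => [ex_r|no_r].
  by case: ex_minnP => r /asboolP Tr min_r; split=> // s /asboolP /min_r.
exfalso; have [r Tr] := sum_of_nonneg_rank1_exists d_gt0 T_ge0.
by apply: no_r; exists r; apply/asboolP.
Qed.

(* Main.v *)
Require Import Defs.
From mathcomp Require Import all_boot all_order all_algebra.
From mathcomp Require Import boolp reals.

(** Upper bound: cutting a tensor along all directions but the last one writes
    it as a sum of its one-dimensional fibres, and a tensor supported on a single
    fibre is a product of coordinate vectors with the vector of its entries.
    There is one fibre for each choice of the first [d - 1] indices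
    ([nonneg_rank_le_fibers], [card_fibers]).

    Lower bound: nonnegative summands cannot cancel, so every rank-1 summand
    of [T] is supported inside the support of [T]; moreover the support of a
    rank-1 tensor is a combinatorial box.  If no two distinct positions of the
    support of [T] differ in a single coordinate, as in an error-detecting code,
    then such a box is a single point, and so the rank of [T] is at least the
    size of its support ([card_code_le_nonneg_rank]).  A parity-check code whose
    last coordinate is the sum of the others modulo the last dimension has this
    property precisely because the last dimension is the largest one
    ([parity_code_isolated]), and it has one word on each fibre. *)

Set Implicit Arguments.
Unset Strict Implicit.
Unset Printing Implicit Defensive.

Import Order.TTheory GRing.Theory Num.Theory.
Local Open Scope ring_scope.

(** * Sums of tensors of rank at most 1 *)

(** The definition of rank asks for nonzero summands; allowing null ones only
    makes the sum longer. *)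
Lemma nonneg_rank_le_card (R : realType) (d : nat) (N : 'I_d -> nat)
    (I : finType) (X : {set I}) (E : I -> tensor R N) :
  (0 < d)%N ->
  (forall x, x \in X -> E x != 0 -> nonneg_rank1 (E x)) ->
  (nonneg_rank (\sum_(x in X) E x)%R <= #|X|)%N.
Proof.
move=> d_gt0 rank1E; pose Y := [set x in X | E x != 0].
have EY : \sum_(x in X) E x = \sum_(x in Y) E x.
  rewrite (bigID (fun x => E x == 0)) /= big1 ?add0r => [|x /andP[_ /eqP]//].
  by apply: eq_bigl => x; rewrite inE.
have rank1Y x : x \in Y -> nonneg_rank1 (E x).
  by rewrite inE => /andP[]; apply: rank1E.
have T_ge0 : nonneg_tensor (\sum_(x in X) E x).
  move=> i; rewrite EY sum_ffunE; apply: sumr_ge0 => x /rank1Y[_ Ex_ge0 _].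
  exact: Ex_ge0.
apply: (@leq_trans #|Y|); last first.
  by apply: subset_leq_card; apply/subsetP => x; rewrite inE => /andP[].
apply: (nonneg_rankP d_gt0 T_ge0).2.
exists (fun k => E (enum_val k)) => [k|]; first exact/rank1Y/enum_valP.
by rewrite EY -(big_enum_val E).
Qed.

Section MultiIndex.

Context (d : nat) (N : 'I_d -> nat).
Implicit Types p q i a : multi_index N.

(** Taking the new coordinate from another multi-index, instead of a bare
    element of ['I_(N j)], avoids casts between the types ['I_(N k)]. *)
Definition replace_coord p q (j : 'I_d) : multi_index N :=
  finfun (fun k => if k == j then q k else p k).

Lemma replace_coord_eq p q j : replace_coord p q j j = q j.
Proof. by rewrite ffunE eqxx. Qed.

Lemma replace_coord_neq p q j k : k != j -> replace_coord p q j k = p k.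
Proof. by move=> /negPf kj; rewrite ffunE kj. Qed.

Definition isolated_coords (S : {set multi_index N}) : Prop :=
  forall p q j, p \in S -> q \in S -> (forall k, k != j -> p k = q k) -> p = q.

(** * The lower bound from isolated supports *)

Definition tensor_support (R : realType) (T : tensor R N) : {set multi_index N} :=
  [set p | T p != 0].

(** The support of a rank-1 tensor is a combinatorial box. *)
Lemma rank1_replace_coord (R : realType) (T : tensor R N) p q j :
  nonneg_rank1 T -> T p != 0 -> T q != 0 -> T (replace_coord p q j) != 0.
Proof.
case=> _ _ [v _ Tv]; rewrite !Tv => /prodf_neq0 vp /prodf_neq0 vq.
by apply/prodf_neq0 => k _; rewrite ffunE; case: ifP => _; [apply: vq|apply: vp].
Qed.

(** Assign to each position of the support a summand that is nonzero there.
    The assignment is injective: a summand nonzero at two positions [p] and [q]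
    is also nonzero at the position obtained from [p] by moving one coordinate
    to its value in [q], and that position would lie in the support. *)
Lemma card_code_le_nonneg_rank (R : realType) (T : tensor R N) r :
  isolated_coords (tensor_support T) -> sum_of_nonneg_rank1 T r ->
  (#|tensor_support T| <= r)%N.
Proof.
set S := tensor_support T => isoS [E rank1E TE].
have suppE k p : E k p != 0 -> p \in S.
  rewrite inE TE sum_ffunE; apply: contra_neq => /psumr_eq0P; apply=> // k' _.
  by have [_ Ek_ge0 _] := rank1E k'; apply: Ek_ge0.
have cover (x : 'I_#|S|) : exists k, E k (enum_val x) != 0.
  have := enum_valP x; rewrite inE TE sum_ffunE => sum_neq0.
  apply/existsP; apply: contraR sum_neq0; rewrite negb_exists => /forallP E0.
  by apply/eqP/big1 => k _; apply/eqP/negPn/E0.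
have [c cP] := fin_all_exists cover.
suff c_inj : injective c by have := leq_card c c_inj; rewrite !card_ord.
move=> x y cxy; apply/enum_val_inj/ffunP => j.
have Ey := cP y; rewrite -cxy in Ey.
have mixS := suppE _ _ (rank1_replace_coord j (rank1E _) (cP x) Ey).
rewrite (isoS _ _ j (enum_valP x) mixS) ?replace_coord_eq // => k kj.
by rewrite replace_coord_neq.
Qed.

(** * Fibres along one direction *)

Hypothesis N_gt0 : forall j, (0 < N j)%N.
Variable l : 'I_d.

Definition residues (s : nat) : multi_index N :=
  finfun (fun k => Ordinal (ltn_pmod s (N_gt0 k))).

(** One representative for each fibre in direction [l]. *)
Definition fibers : {set multi_index N} :=
  [set a : multi_index N | a l == residues 0 l].

Definition fiber_of i := replace_coord i (residues 0) l.

Lemma fiber_of_fibers i : fiber_of i \in fibers.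
Proof. by rewrite inE replace_coord_eq. Qed.

Lemma residues_id i j : residues (i j) j = i j.
Proof. by rewrite ffunE; apply: val_inj; rewrite /= modn_small. Qed.

Lemma card_fibers : #|fibers| = (\prod_(j | j != l) N j)%N.
Proof.
pose F j : pred 'I_(N j) := [pred x | (j == l) ==> (x == residues 0 j)].
have -> : #|fibers| = #|(family F : simpl_pred {dffun forall j, 'I_(N j)})|.
  apply: eq_card => a; rewrite inE; apply/idP/familyP => [al j | /(_ l)].
    by rewrite inE /=; apply/implyP => /eqP ->.
  by rewrite inE /= eqxx.
rewrite card_family /image_mem foldrE big_map big_enum /= (bigD1 l)//=.
rewrite (_ : #|F l| = 1%N); last first.
  by rewrite -(card1 (residues 0 l)); apply: eq_card => x; rewrite !inE eqxx.
rewrite mul1n; apply: eq_bigr => j /negPf jl.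
by rewrite -[RHS]card_ord; apply: eq_card => x; rewrite !inE jl.
Qed.

Definition fiber_part (R : realType) (T : tensor R N) a : tensor R N :=
  [ffun i => if fiber_of i == a then T i else 0].

Lemma sum_fiber_part (R : realType) (T : tensor R N) :
  T = \sum_(a in fibers) fiber_part T a.
Proof.
apply/ffunP => i; rewrite sum_ffunE (bigD1 (fiber_of i)) ?fiber_of_fibers//=.
rewrite ffunE eqxx big1 ?addr0// => a /andP[_ ai].
by rewrite ffunE eq_sym (negPf ai).
Qed.

(** On the fibre of [a], the tensor is the product of its entries along [l]
    with the coordinate vectors at [a j] in the other directions. *)
Lemma fiber_part_rank1 (R : realType) (T : tensor R N) a :
  nonneg_tensor T -> a \in fibers -> fiber_part T a != 0 ->
  nonneg_rank1 (fiber_part T a).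
Proof.
move=> T_ge0; rewrite inE => /eqP al Ta_neq0; split=> //.
  by move=> i; rewrite ffunE; case: ifP.
exists (fun j => \col_x if j == l then T (replace_coord a (residues x) l)
                        else (x == a j)%:R).
  by move=> j x; rewrite mxE; case: ifP => _; [apply: T_ge0 | apply: ler0n].
move=> i; rewrite (bigD1 l)//= mxE eqxx ffunE; case: eqVneq => [ia|ia].
  rewrite big1 ?mulr1 => [|j jl].
    congr (T _); apply/ffunP => j; have [->|jl] := eqVneq j l.
      by rewrite replace_coord_eq residues_id.
    by rewrite replace_coord_neq// -ia replace_coord_neq.
  by rewrite mxE (negPf jl) -ia replace_coord_neq// eqxx.
have [j jl ij] : exists2 j, j != l & i j != a j.
  apply/exists_inP; apply: contraR ia; rewrite negb_exists_in => /forall_inP eq_i.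
  apply/eqP/ffunP => j; have [->|jl] := eqVneq j l.
    by rewrite replace_coord_eq.
  by rewrite replace_coord_neq//; apply/eqP/negPn/eq_i.
by rewrite (bigD1 j)//= mxE (negPf jl) (negPf ij) mul0r mulr0.
Qed.

Lemma nonneg_rank_le_fibers (R : realType) (T : tensor R N) :
  (0 < d)%N -> nonneg_tensor T ->
  (nonneg_rank T <= \prod_(j | j != l) N j)%N.
Proof.
move=> d_gt0 T_ge0; rewrite [T]sum_fiber_part -card_fibers.
by apply: nonneg_rank_le_card => // a aF; apply: fiber_part_rank1.
Qed.

(** * The parity-check code *)

Definition coord_sum i : nat := (\sum_(j | j != l) i j)%N.

Definition parity_code : {set multi_index N} :=
  [set i : multi_index N | i l == residues (coord_sum i) l].

Lemma eq_coord_sum p q :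
  (forall k, k != l -> p k = q k) -> coord_sum p = coord_sum q.
Proof. by move=> pq; apply: eq_bigr => k /pq ->. Qed.

(** Each fibre contains the word obtained by completing its representative
    with the check symbol. *)
Lemma card_parity_code_ge : (\prod_(j | j != l) N j <= #|parity_code|)%N.
Proof.
pose word a := replace_coord a (residues (coord_sum a)) l.
rewrite -card_fibers -(@card_in_imset _ _ word).
  apply/subset_leq_card/subsetP => _ /imsetP[a _ ->].
  rewrite inE replace_coord_eq (@eq_coord_sum a (word a)) // => k kl.
  by rewrite replace_coord_neq.
move=> a b; rewrite !inE => /eqP al /eqP bl ab.
apply/ffunP => k; have [->|kl] := eqVneq k l; first by rewrite al bl.
by have /ffunP/(_ k) := ab; rewrite !replace_coord_neq.
Qed.

(** Changing one coordinate [j != l] changes the sum by a nonzero amount smaller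
    than [N j <= N l], hence changes its residue modulo [N l]. *)
Lemma parity_code_isolated :
  (forall j, (N j <= N l)%N) -> isolated_coords parity_code.
Proof.
move=> N_le p q j; rewrite !inE => /eqP pl /eqP ql pq.
have pqj : p j = q j; last first.
  by apply/ffunP => k; have [->|/pq] := eqVneq k j.
have [jl|jl] := eqVneq j l.
  by subst j; rewrite pl ql (eq_coord_sum pq).
have lj : l != j by rewrite eq_sym.
have := congr1 val (pq l lj); rewrite pl ql !ffunE /= /coord_sum.
rewrite !(bigD1 j jl) /=.
rewrite (eq_bigr (fun k => q k : nat)); last by move=> k /andP[_ /pq ->].
move/eqP; rewrite eqn_modDr !modn_small; first by move=> /eqP/val_inj.
all: exact: leq_trans (ltn_ord _) (N_le j).
Qed.

Lemma nonneg_rank_parity_code (R : realType) :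
  (0 < d)%N -> (forall j, (N j <= N l)%N) ->
  exists T : tensor R N,
    nonneg_tensor T /\ nonneg_rank T = (\prod_(j | j != l) N j)%N.
Proof.
move=> d_gt0 N_le; pose T : tensor R N := [ffun i => (i \in parity_code)%:R].
have T_ge0 : nonneg_tensor T by move=> i; rewrite ffunE ler0n.
have suppT : tensor_support T = parity_code.
  by apply/setP => i; rewrite inE ffunE pnatr_eq0 eqb0 negbK.
exists T; split=> //; apply/eqP; rewrite eqn_leq nonneg_rank_le_fibers//=.
apply: leq_trans card_parity_code_ge _; rewrite -suppT.
apply: card_code_le_nonneg_rank; last exact: (nonneg_rankP d_gt0 T_ge0).1.
by rewrite suppT; apply: parity_code_isolated.
Qed.

End MultiIndex.

(** * The maximal nonnegative rank *)

Theorem theorem3p3 (R : realType) (d : nat) (hd : (0 < d)%N) (N : 'I_d -> nat)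
    (N_gt0 : forall j : 'I_d, (0 < N j)%N)
    (N_le : forall i j : 'I_d, (i <= j)%N -> (N i <= N j)%N) :
  let M := (\prod_(j < d | (j.+1 < d)%N) N j)%N in
  (forall T : tensor R N, nonneg_tensor T -> (nonneg_rank T <= M)%N) /\
  (exists T : tensor R N, nonneg_tensor T /\ nonneg_rank T = M).
Proof.
case: d hd N N_gt0 N_le => // d hd N N_gt0 N_le M.
have -> : M = (\prod_(j | j != ord_max) N j)%N.
  by apply: eq_bigl => j; rewrite -val_eqE ltnS /= ltn_neqAle -ltnS ltn_ord andbT.
split=> [T T_ge0|]; first exact: nonneg_rank_le_fibers.
by apply: nonneg_rank_parity_code => // j; apply: N_le; rewrite -ltnS.
Qed.
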